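(* Let $X$ be an infinite-dimensional Fréchet space over $\mathbb{K}\in\{\mathbb{R},\mathbb{C}\}$, let $(p_j)_{j\in\mathbb{N}}$ be a separating increasing sequence of seminorms inducing the topology of $X$, let $d(x,y)=\sum_{j=1}^\infty 2^{-j}\min(1,p_j(x-y))$, and let $T\colon X\to X$ be a continuous linear operator. Then the following assertions are equivalent: (1) $T$ admits a semi-irregular vector; (2) $T$ admits a Li-Yorke chaotic pair; (3) $T$ admits an $m$-irregular vector for some $m\in\mathbb{N}$; (4) $T$ is Li-Yorke $m$-extremely chaotic for some $m\in\mathbb{N}$; (5) $T$ is Li-Yorke $m$-extremely sensitive for some $m\in\mathbb{N}$; (6) the restriction of $T$ to some closed $T$-invariant subspace $\widetilde{X}$ of $X$ has a residual (in $\widetilde X$) set of $m$-irregular points for some $m\in\mathbb{N}$.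
   Context: $\mathbb{N}$ is the set of positive integers and $\mathbf 0$ is the zero vector of $X$. A set is residual in a space if it contains a dense $G_\delta$ subset of that space. A subset $Y$ is $T$-invariant if $TY\subset Y$. A vector $x\in X$ is semi-irregular for $T$ if $\liminf_{n\to\infty} d(T^nx,\mathbf 0)=0$ and $\limsup_{n\to\infty} d(T^nx,\mathbf 0)>0$. For $m\in\mathbb{N}$, $x$ is $m$-irregular for $T$ if $\liminf_{n\to\infty} d(T^nx,\mathbf 0)=0$ and $\limsup_{n\to\infty} p_m(T^nx)=\infty$. A pair $(x,y)\in X\times X$ is Li-Yorke chaotic if $\liminf_{n\to\infty}d(T^nx,T^ny)=0$ and $\limsup_{n\to\infty}d(T^nx,T^ny)>0$; it is Li-Yorke $m$-extremely chaotic if $\liminf_{n\to\infty}d(T^nx,T^ny)=0$ and $\limsup_{n\to\infty}p_m(T^nx-T^ny)=\infty$. $T$ is Li-Yorke $m$-extremely chaotic if there exists an uncountable set $K\subset X$ such that any two distinct points of $K$ form a Li-Yorke $m$-extremely chaotic pair. $T$ is Li-Yorke $m$-extremely sensitive if for every $x\in X$ and $\varepsilon>0$ there exists $y\in X$ with $d(x,y)<\varepsilon$ such that $(x,y)$ is Li-Yorke $m$-extremely chaotic. *)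

(* Defs.v *)
From mathcomp Require Import all_boot all_order all_algebra.
From mathcomp Require Import all_classical all_reals all_analysis.
From mathcomp Require Import borel_hierarchy complex.

Set Implicit Arguments.
Unset Strict Implicit.
Unset Printing Implicit Defensive.

Import Order.TTheory GRing.Theory Num.Theory.
Import numFieldNormedType.Exports.

Local Open Scope classical_set_scope.
Local Open Scope ring_scope.

Variant scalar_kind := RealScalars | ComplexScalars.

Definition scalars (R : realType) (k : scalar_kind) : numFieldType :=
  match k with
  | RealScalars => R
  | ComplexScalars => R[i]%C
  end.

(* The norm of the numFieldType R[i] takes its values in R[i] itself, hence the
   real part. *)
Definition scalar_abs (R : realType) (k : scalar_kind) : scalars R k -> R :=
  match k return scalars R k -> R with
  | RealScalars => fun a : R => `|a|
  | ComplexScalars => fun a : R[i]%C => complex.Re `|a|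
  end.

Section Frechet.
Context (R : realType) (k : scalar_kind) (X : tvsType (scalars R k)).

Definition seminorm (q : X -> R) : Prop :=
  [/\ forall x, 0 <= q x,
      forall x y, q (x + y) <= q x + q y &
      forall (a : scalars R k) x, q (a *: x) = scalar_abs a * q x].

(* Sequences of seminorms are indexed from 0 : p j stands for the (j+1)-st
   seminorm of the sequence (p_j)_{j >= 1}. *)
Definition induces_topology (p : nat -> X -> R) : Prop :=
  forall (x : X) (U : set X), nbhs x U <->
    exists n e, 0 < e /\
      [set y | forall j, (j <= n)%N -> p j (y - x) < e] `<=` U.

Definition defining_seminorms (p : nat -> X -> R) : Prop :=
  [/\ forall j, seminorm (p j),
      forall x, (forall j, p j x = 0) -> x = 0,
      forall j x, p j x <= p j.+1 x &
      induces_topology p].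

(* Completeness refers to the uniformity given by the vector space structure.
   A tvsType also carries a uniformType structure, but that one is only required
   to induce the same topology, so the library's cauchy is not used here. *)
Definition tvs_cauchy (F : set_system X) : Prop :=
  (fun xy : X * X => xy.1 - xy.2) @ (F, F) --> (0 : X).

Definition tvs_complete : Prop :=
  forall F : set_system X, ProperFilter F -> tvs_cauchy F ->
    exists l : X, F --> l.

Definition frechet : Prop :=
  (exists p, defining_seminorms p) /\ tvs_complete.

Definition finite_dimensional : Prop :=
  exists (n : nat) (e : 'I_n -> X), forall x : X,
    exists c : 'I_n -> scalars R k, x = \sum_(i < n) c i *: e i.

Definition frechet_dist (p : nat -> X -> R) (x y : X) : R :=
  limn (series (fun j => 2 ^- j.+1 * Num.min 1 (p j (x - y)))).

Section Irregularity.
Variables (p : nat -> X -> R) (T : X -> X).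
Local Notation d := (frechet_dist p).

Definition semi_irregular (x : X) : Prop :=
  limn_einf (fun n => (d (iter n T x) 0)%:E) = 0%E /\
  (0 < limn_esup (fun n => (d (iter n T x) 0)%:E))%E.

Definition irregular (m : nat) (x : X) : Prop :=
  limn_einf (fun n => (d (iter n T x) 0)%:E) = 0%E /\
  limn_esup (fun n => (p m (iter n T x))%:E) = +oo%E.

Definition LY_chaotic_pair (x y : X) : Prop :=
  limn_einf (fun n => (d (iter n T x) (iter n T y))%:E) = 0%E /\
  (0 < limn_esup (fun n => (d (iter n T x) (iter n T y))%:E))%E.

Definition LY_extremely_chaotic_pair (m : nat) (x y : X) : Prop :=
  limn_einf (fun n => (d (iter n T x) (iter n T y))%:E) = 0%E /\
  limn_esup (fun n => (p m (iter n T x - iter n T y))%:E) = +oo%E.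

Definition LY_extremely_chaotic (m : nat) : Prop :=
  exists K : set X, ~ countable K /\
    forall x y, K x -> K y -> x <> y -> LY_extremely_chaotic_pair m x y.

Definition LY_extremely_sensitive (m : nat) : Prop :=
  forall (x : X) (eps : R), 0 < eps ->
    exists y, d x y < eps /\ LY_extremely_chaotic_pair m x y.

End Irregularity.

Definition closed_invariant_subspace (T : X -> X) (Y : set X) : Prop :=
  [/\ closed Y, submod_closed (mem Y) & T @` Y `<=` Y].

End Frechet.

Definition residual (Z : topologicalType) (A : set Z) : Prop :=
  exists G : set Z, [/\ Gdelta G, dense G & G `<=` A].

(* Main.v *)
Require Import Defs.
From mathcomp Require Import all_boot all_order all_algebra.
From mathcomp Require Import all_classical all_reals all_analysis.
From mathcomp Require Import complex ring lra.

(** All six properties are equivalent because a single semi-irregular vector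
    produces a closed invariant subspace in which the irregular vectors form a
    residual set.

    Linearity takes care of everything else.  The orbits of [x] and [y] differ
    by the orbit of [x - y], and [d] only depends on differences, so a chaotic
    pair is the same thing as a semi-irregular (resp. irregular) difference
    ([LY_chaotic_pairP], [LY_extremely_chaotic_pairP]).  Nonzero multiples of an
    [m]-irregular vector [u] are [m]-irregular; hence the real line spanned by
    [u] is an uncountable set witnessing extreme chaos, and [y - c u] with [c]
    small witnesses extreme sensitivity at [y].

    The substantial step is [residual_irregular].  Given [x] semi-irregular,
    choose times [f i] tending to infinity along which the orbit of [x] tends to
    0, let [V] be the invariant subspace of all [y] whose orbit tends to 0 along
    these same times, and let [Y] be the closure of [V].  By construction the
    vectors whose orbit comes arbitrarily close to 0 are dense in [Y].  For
    large values of the orbit there is a dichotomy in the spirit of the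
    Banach-Steinhaus theorem ([orbits_unbounded_or_equicontinuous]): either for
    some seminorm [p m] the vectors of [Y] that reach any prescribed size after
    any prescribed time are dense in [Y], or the iterates of [T] are eventually
    equicontinuous on [Y].  The second case is impossible: once the orbit of [x]
    comes close to 0 it would stay close to 0, against semi-irregularity.  In
    the first case the [m]-irregular vectors of [Y] contain a countable
    intersection of open sets that are dense in [Y], and Baire's theorem in the
    complete space [Y] ([Baire_closed_subset]) concludes. *)

Set Implicit Arguments.
Unset Strict Implicit.
Unset Printing Implicit Defensive.

Import Order.TTheory GRing.Theory Num.Theory.
Import numFieldNormedType.Exports.

Local Open Scope classical_set_scope.
Local Open Scope ring_scope.

(** * Upper and lower limits through frequently occurring inequalities *)

Definition frequently (P : nat -> Prop) : Prop :=
  forall N, exists2 n, (N <= n)%N & P n.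

Lemma sub_frequently (P Q : nat -> Prop) :
  (forall n, P n -> Q n) -> frequently P -> frequently Q.
Proof. by move=> PQ fP N; have [n Nn /PQ] := fP N; exists n. Qed.

Section limsup_liminf.
Context {R : realType}.
Implicit Types (u : nat -> R) (w : nat -> \bar R).

Lemma lt_limn_esup w y :
  (y < limn_esup w)%E -> frequently (fun n => y < w n)%E.
Proof.
move=> yw N; have : (y < ereal_sup [set w n | n in [set n | (N <= n)%N]])%E.
  apply: (lt_le_trans yw); apply: ereal_inf_lbound => /=.
  by exists [set n | (N <= n)%N] => //; exists N.
by move=> /ereal_sup_gt[_ [n Nn <-]]; exists n.
Qed.

Lemma le_limn_esup w y :
  frequently (fun n => y <= w n)%E -> (y <= limn_esup w)%E.
Proof.
move=> fw; apply: le_ereal_inf_tmp => _ [A [N _ NA] <-].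
have [n Nn /le_trans] := fw N; apply.
by apply: ereal_sup_ubound; exists n => //; exact: NA.
Qed.

Lemma limn_einf0P u : (forall n, 0 <= u n) ->
  limn_einf (fun n => (u n)%:E) = 0%E <->
  forall e, 0 < e -> frequently (fun n => u n < e).
Proof.
move=> u0; rewrite /limn_einf; split=> [+ e e0|fu].
  move/eqP; rewrite oppe_eq0 => /eqP w0.
  have : ((- e)%:E < limn_esup (\- (fun n => (u n)%:E)))%E.
    by rewrite w0 lte_fin oppr_lt0.
  by move/lt_limn_esup; apply: sub_frequently => n; rewrite lte_fin ltrN2.
apply/eqP; rewrite oppe_eq0 eq_le; apply/andP; split.
  rewrite leNgt; apply/negP => /lt_limn_esup/(_ 0%N)[n _].
  by rewrite lte_fin oppr_gt0 ltNge u0.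
apply/lee_addgt0Pr => e e0; rewrite -leeBlDr// sub0e; apply: le_limn_esup.
by apply: sub_frequently (fu e e0) => n une; rewrite lee_fin lerN2 ltW.
Qed.

Lemma limn_esup_gt0P u :
  (0 < limn_esup (fun n => (u n)%:E))%E <->
  exists2 e, 0 < e & frequently (fun n => e <= u n).
Proof.
split=> [w0|[e e0 fu]].
  have [e e0 ew] : exists2 e, 0 < e & (e%:E < limn_esup (fun n => (u n)%:E))%E.
    case: (limn_esup _) w0 => [r| |]// r0; last by exists 1; rewrite ?ltry.
    rewrite lte_fin in r0; exists (r / 2); first by rewrite divr_gt0.
    by rewrite lte_fin ltr_pdivrMr// ltr_pMr// ltr1n.
  by exists e => //; apply: sub_frequently (lt_limn_esup ew) => n /ltW.
by apply: (@lt_le_trans _ _ e%:E) => //; apply: le_limn_esup.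
Qed.

Lemma limn_esup_pinftyP u :
  limn_esup (fun n => (u n)%:E) = +oo%E <->
  forall M, frequently (fun n => M < u n).
Proof.
split=> [w M|fu].
  have := @lt_limn_esup (fun n => (u n)%:E) M%:E; rewrite w ltry => /(_ isT).
  by [].
apply/eqyP => M _; apply: le_limn_esup.
by apply: sub_frequently (fu M) => n /ltW.
Qed.

End limsup_liminf.

(** * Real scalars in the field of scalars *)

Section scalars.
Context {R : realType} {k : scalar_kind}.

Definition real_scalar : R -> scalars R k :=
  match k return R -> scalars R k with
  | RealScalars => id
  | ComplexScalars => fun r => r%:C%C
  end.

Lemma real_scalarB r s : real_scalar (r - s) = real_scalar r - real_scalar s.
Proof. by rewrite /real_scalar; case: k => //; rewrite rmorphB. Qed.

Lemma real_scalar1 : real_scalar 1 = 1.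
Proof. by rewrite /real_scalar; case: k. Qed.

Lemma scalar_abs_real r : scalar_abs (real_scalar r) = `|r|.
Proof.
rewrite /scalar_abs /real_scalar; case: k => //=.
by rewrite expr0n /= addr0 sqrtr_sqr.
Qed.

Lemma scalar_absN (a : scalars R k) : scalar_abs (- a) = scalar_abs a.
Proof. by move: a; rewrite /scalar_abs; case: k => a; rewrite normrN. Qed.

Lemma scalar_abs_ge0 (a : scalars R k) : 0 <= scalar_abs a.
Proof.
move: a; rewrite /scalar_abs; case: k => //= a.
by case: a => x y /=; rewrite sqrtr_ge0.
Qed.

Lemma real_scalar_inj : injective real_scalar.
Proof.
move=> r s rs; apply/eqP; rewrite -subr_eq0 -normr_eq0 -scalar_abs_real.
by rewrite real_scalarB rs -real_scalarB scalar_abs_real subrr normr0.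
Qed.

End scalars.

(** A countable set is Lebesgue-null, whereas the line has infinite measure. *)
Lemma uncountable_reals (R : realType) : ~ countable [set: R].
Proof.
move=> /countable_lebesgue_measure0.
by rewrite -set_itvNyy lebesgue_measure_itv /=.
Qed.

(** * Topology and metric in terms of the seminorms *)

Section seminorm_calculus.
Context {R : realType} {k : scalar_kind} {X : tvsType (scalars R k)}.
Context {p : nat -> X -> R} (hp : defining_seminorms p).

Lemma seminorm_ge0 j x : 0 <= p j x.
Proof. by have [/(_ j)[]] := hp. Qed.

Lemma seminormD j x y : p j (x + y) <= p j x + p j y.
Proof. by have [/(_ j)[]] := hp. Qed.

Lemma seminormZ j a x : p j (a *: x) = scalar_abs a * p j x.
Proof. by have [/(_ j)[]] := hp. Qed.

Lemma seminormN j x : p j (- x) = p j x.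
Proof.
rewrite -scaleN1r seminormZ scalar_absN -real_scalar1 scalar_abs_real.
by rewrite normr1 mul1r.
Qed.

Lemma seminorm0 j : p j 0 = 0.
Proof.
by rewrite -(scale0r 0) -(subrr 1) -real_scalar1 -real_scalarB seminormZ
  scalar_abs_real subrr normr0 mul0r.
Qed.

Lemma seminorm_distC j x y : p j (x - y) = p j (y - x).
Proof. by rewrite -seminormN opprB. Qed.

Lemma seminorm_dist_triangle j z x y : p j (x - y) <= p j (x - z) + p j (z - y).
Proof. by have := seminormD j (x - z) (z - y); rewrite addrA subrK. Qed.

(** The weight [1 + |a|] instead of [|a|] avoids a case distinction on [a = 0]. *)
Lemma seminorm_linear_lt n (a : scalars R k) x y e :
    p n x < e / 2 / (1 + scalar_abs a) -> p n y < e / 2 ->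
  p n (a *: x + y) < e.
Proof.
have c0 : 0 < 1 + scalar_abs a by rewrite ltr_pwDl// scalar_abs_ge0.
move=> xe ye; rewrite [ltRHS]splitr.
apply: le_lt_trans (seminormD _ _ _) _; apply: ler_ltD => //.
rewrite seminormZ -(@ler_pM2r _ (1 + scalar_abs a)^-1) ?invr_gt0//.
apply: le_trans (ltW xe); rewrite mulrAC ler_piMl ?seminorm_ge0//.
by rewrite ler_pdivrMr// mul1r lerDr.
Qed.

Lemma seminorm_homo i j x : (i <= j)%N -> p i x <= p j x.
Proof.
have [_ _ pS _] := hp.
move=> /subnK <-; elim: (j - i)%N => // n IHn.
by rewrite addSn (le_trans IHn).
Qed.

(** Since the seminorms increase, a single one of them suffices to describe a
    basic neighbourhood. *)
Lemma nbhs_seminormP (x : X) (U : set X) : nbhs x U <->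
  exists n e, 0 < e /\ [set y | p n (y - x) < e] `<=` U.
Proof.
have [_ _ _ ip] := hp; split=> [/ip[n [e [e0 sU]]]|[n [e [e0 sU]]]].
  exists n, e; split=> // y /= ye; apply: sU => /= j jn.
  exact: le_lt_trans (seminorm_homo _ jn) ye.
by apply/ip; exists n, e; split=> // y /= ye; apply: sU => /=; exact: ye.
Qed.

Lemma nbhs_seminorm_ball (x : X) n e : 0 < e -> nbhs x [set y | p n (y - x) < e].
Proof. by move=> e0; apply/nbhs_seminormP; exists n, e; split. Qed.

Lemma closure_seminormP (A : set X) (x : X) : closure A x <->
  forall n e, 0 < e -> exists2 z, A z & p n (z - x) < e.
Proof.
split=> [Ax n e e0|Ax U /nbhs_seminormP[n [e [e0 sU]]]].
  by have [z [Az ze]] := Ax _ (nbhs_seminorm_ball x n e0); exists z.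
by have [z Az ze] := Ax n e e0; exists z; split=> //; exact: sU.
Qed.

Lemma continuous_seminorm j : continuous (p j).
Proof.
move=> x; apply/cvgrPdist_lt => e e0.
apply: filterS (nbhs_seminorm_ball x j e0) => y /= ye.
rewrite distrC ltr_norml; apply/andP; split.
  rewrite ltrBrDl ltrBlDr; apply: le_lt_trans (_ : _ <= p j y + p j (y - x)) _.
    by rewrite seminorm_distC addrC -{1}(subrK y x) seminormD.
  by rewrite ltrD2l.
rewrite ltrBlDr; apply: le_lt_trans (_ : _ <= p j (y - x) + p j x) _.
  by rewrite -{1}(subrK x y) seminormD.
by rewrite ltrD2r.
Qed.

Lemma continuous_seminorm_bound (f : X -> X) a j e :
    continuous f -> 0 < e ->
  exists n d, 0 < d /\ forall x, p n (x - a) < d -> p j (f x - f a) < e.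
Proof.
move=> cf e0; have /nbhs_seminormP[n [d [d0 sU]]] := cf a _ (nbhs_seminorm_ball (f a) j e0).
by exists n, d; split.
Qed.

Lemma tvs_complete_seq (u : nat -> X) : tvs_complete X ->
    (forall n e, 0 < e -> exists N, forall i j, (N <= i)%N -> (N <= j)%N ->
      p n (u i - u j) < e) ->
  exists l : X, u @ \oo --> l.
Proof.
move=> cX cu; apply: cX => U /nbhs_seminormP[n [e [e0 sU]]].
have [N uN] := cu n e e0.
exists (u @` [set i | (N <= i)%N], u @` [set i | (N <= i)%N]) => /=.
  by split; exists N => // i Ni; exists i.
by move=> [_ _] /= [[i Ni <-] [j Nj <-]]; apply: sU; rewrite /= subr0 uN.
Qed.

Section metric.
Implicit Types (x y : X).

Let d := frechet_dist p.
Let term x y j : R := 2 ^- j.+1 * Num.min 1 (p j (x - y)).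

Let term_ge0 x y j : 0 <= term x y j.
Proof.
by rewrite mulr_ge0 ?invr_ge0 ?exprn_ge0// le_min ler01 seminorm_ge0.
Qed.

Let term_le x y j : term x y j <= 2 ^- j.+1.
Proof.
by rewrite ler_piMr ?invr_ge0 ?exprn_ge0// ge_min lexx.
Qed.

Lemma is_cvg_frechet_dist x y : cvgn (series (term x y)).
Proof.
apply: (@series_le_cvg _ _ (geometric 2^-1 2^-1)) => //.
- by move=> n; rewrite mulr_ge0 ?exprn_ge0.
- by move=> n; rewrite /= -exprS exprVn term_le.
- by apply: is_cvg_geometric_series; rewrite ger0_norm// invf_lt1// ltr1n.
Qed.

Lemma frechet_dist_ge_partial x y n : series (term x y) n <= d x y.
Proof.
apply: nondecreasing_cvgn_le; last exact: is_cvg_frechet_dist.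
by apply: nondecreasing_series => i _ _; exact: term_ge0.
Qed.

Lemma frechet_dist_ge0 x y : 0 <= d x y.
Proof. by have := frechet_dist_ge_partial x y 0; rewrite seriesEnat /= big_geq. Qed.

Lemma frechet_dist_ge_seminorm m x y : term x y m <= d x y.
Proof.
apply: le_trans (frechet_dist_ge_partial x y m.+1).
by rewrite seriesEnat /= big_nat_recr//= lerDr sumr_ge0.
Qed.

(** The terms of index greater than [m] add up to at most [2 ^- m], and the
    others are controlled by the single seminorm [p m]. *)
Lemma frechet_dist_lt e : 0 < e ->
  exists m e', 0 < e' /\ forall x y, p m (x - y) < e' -> d x y < e.
Proof.
move=> e0.
have [m me] : exists m, 2 ^- m < e / 2 :> R.
  have /cvgrPdist_lt/(_ (e / 2)) : (fun n => 2^-1 ^+ n : R) @ \oo --> (0 : R).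
    by apply: cvg_expr; rewrite ger0_norm// invf_lt1// ltr1n.
  rewrite divr_gt0// => /(_ isT)[m _ /(_ m)] /=.
  by rewrite leqnn sub0r normrN ger0_norm ?exprn_ge0// exprVn => /(_ isT) ?; exists m.
exists m, (e / 2); split=> [|x y xy]; first by rewrite divr_gt0.
suff dle : d x y <= p m (x - y) + 2 ^- m.
  by apply: le_lt_trans dle _; rewrite [ltRHS]splitr ltrD.
set c := p m (x - y); have c0 : 0 <= c := seminorm_ge0 _ _.
apply: limr_le; first exact: is_cvg_frechet_dist.
apply: nearW => n; rewrite seriesEnat /=.
(* The n-th partial sum: the geometric weights times [c] bound the terms of
   index at most [m]; the later ones are bounded by their weights alone. *)
apply: (@le_trans _ _ (c * (1 - 2 ^- n) + (if (m < n)%N then 2 ^- m - 2 ^- n else 0))).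
  elim: n => [|n IHn].
    by rewrite big_geq// expr0 invr1 subrr mulr0 addr0.
  rewrite big_nat_recr//= -/(term x y n); set s := \sum_(_ <= _ < _) _ in IHn *.
  have hS : 2 ^- n = 2 ^- n.+1 + 2 ^- n.+1 :> R.
    by rewrite exprS invfM; field; rewrite expf_neq0.
  have chS : c * 2 ^- n = c * 2 ^- n.+1 + c * 2 ^- n.+1 by rewrite hS mulrDr.
  have e1 : 0 <= c * 2 ^- n.+1 by rewrite mulr_ge0 ?invr_ge0 ?exprn_ge0.
  have t1 := term_le x y n.
  rewrite ltnS; case: ltngtP IHn => [mn|nm|mn] IHn.
  - lra.
  - have : term x y n <= c * 2 ^- n.+1.
      rewrite /term mulrC ler_wpM2r ?invr_ge0 ?exprn_ge0// ge_min; apply/orP; right.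
      exact: seminorm_homo (ltnW nm).
    lra.
  - rewrite mn; lra.
have n0 : 0 <= 2 ^- n :> R by rewrite invr_ge0 exprn_ge0.
have m0 : 0 <= 2 ^- m :> R by rewrite invr_ge0 exprn_ge0.
have cn : 0 <= c * 2 ^- n by rewrite mulr_ge0.
by case: ifP => _; lra.
Qed.

(** A small distance makes every seminorm small because all the weights are
    positive; [frechet_dist_lt] gives the converse. *)
Lemma liminf_frechet_dist0P (u v : nat -> X) :
  limn_einf (fun n => (d (u n) (v n))%:E) = 0%E <->
  forall m e, 0 < e -> frequently (fun n => p m (u n - v n) < e).
Proof.
rewrite limn_einf0P; last by move=> n; exact: frechet_dist_ge0.
split=> [fd m e e0|fp e /frechet_dist_lt[m [e' [e'0 de']]]]; last first.
  by apply: sub_frequently (fp m e' e'0) => n /de'.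
have c0 : 0 < Num.min 1 e by rewrite lt_min ltr01.
have : 0 < 2 ^- m.+1 * Num.min 1 e by rewrite mulr_gt0// invr_gt0 exprn_gt0.
move=> /fd; apply: sub_frequently => n /(le_lt_trans (frechet_dist_ge_seminorm m _ _)).
rewrite /term ltr_pM2l ?invr_gt0 ?exprn_gt0// lt_min => /andP[+ +].
by rewrite !gt_min ltxx/= => p1 /orP[/(lt_trans p1)|//].
Qed.

Lemma limsup_frechet_distP (u v : nat -> X) :
  (0 < limn_esup (fun n => (d (u n) (v n))%:E))%E <->
  exists m e, 0 < e /\ frequently (fun n => e <= p m (u n - v n)).
Proof.
rewrite limn_esup_gt0P; split=> [[e + fd]|[m [e [e0 fp]]]].
  move=> /frechet_dist_lt[m [e' [e'0 de']]]; exists m, e'; split=> //.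
  by apply: sub_frequently fd => n; rewrite !leNgt; apply: contra => /de'.
exists (2 ^- m.+1 * Num.min 1 e).
  by rewrite mulr_gt0 ?invr_gt0 ?exprn_gt0// lt_min ltr01.
apply: sub_frequently fp => n en.
apply: le_trans (frechet_dist_ge_seminorm m _ _).
rewrite ler_pM2l ?invr_gt0 ?exprn_gt0// le_min !ge_min lexx /=.
by rewrite en orbT.
Qed.

End metric.
End seminorm_calculus.

(** * Baire's theorem in a closed subset *)

Section baire.
Context {R : realType} {k : scalar_kind} {X : tvsType (scalars R k)}.
Context {p : nat -> X -> R} (hp : defining_seminorms p).

(** One step of the construction of nested balls; the index [m] of the seminorm
    grows and the radius [r] decreases with [i], which makes the sequence of
    centres Cauchy for every seminorm. *)
Lemma shrink_ball (Y U : set X) i y n e :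
    open U -> Y `<=` closure (Y `&` U) -> Y y -> 0 < e ->
  exists z m r, [/\ Y z, 0 < r, (i <= m)%N, r <= i.+1%:R^-1 &
    [set x | p m (x - z) <= r] `<=` [set x | p n (x - y) < e] `&` U].
Proof.
move=> oU dU Yy e0; have [z [Yz Uz] zy] := (closure_seminormP hp _ _).1 (dU y Yy) n e e0.
have /(nbhs_seminormP hp)[n' [e' [e'0 sU]]] := open_nbhs_nbhs (conj oU Uz).
pose m := maxn i (maxn n n').
pose r := Num.min i.+1%:R^-1 (Num.min ((e - p n (z - y)) / 2) (e' / 2)).
have half (t : R) : 0 < t -> t / 2 < t.
  by move=> t0; rewrite ltr_pdivrMr// ltr_pMr// ltr1n.
have small j t x : (j <= m)%N -> 0 < t -> r <= t / 2 -> p m (x - z) <= r ->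
    p j (x - z) < t.
  move=> jm t0 rt xr; apply: le_lt_trans (half t t0).
  by apply: le_trans rt; apply: le_trans xr; exact: seminorm_homo.
exists z, m, r; split=> //.
- by rewrite !lt_min invr_gt0 ltr0Sn !divr_gt0// subr_gt0.
- exact: leq_maxl.
- by rewrite /r ge_min lexx.
move=> x xr; split=> /=.
  apply: le_lt_trans (seminorm_dist_triangle hp _ z _ _) _; rewrite -ltrBrDr.
  by apply: small xr; rewrite ?subr_gt0// /m /r ?ge_min ?leq_max ?lexx ?leqnn ?orbT.
by apply: sU; apply: small xr; rewrite // /m /r ?ge_min ?leq_max ?lexx ?leqnn ?orbT.
Qed.

(** Baire's theorem relative to [Y], where density of [A] in [Y] is expressed as
    [Y `<=` closure (Y `&` A)].  The nested balls are centred in [Y], which is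
    closed, so the limit of their centres lies in [Y] and in all the [F i]. *)
Lemma Baire_closed_subset (Y : set X) (F : nat -> set X) :
    tvs_complete X -> closed Y ->
    (forall i, open (F i)) -> (forall i, Y `<=` closure (Y `&` F i)) ->
  Y `<=` closure (Y `&` \bigcap_i F i).
Proof.
move=> cX clY oF dF y0 Yy0; apply/(closure_seminormP hp) => n0 e0 e0_gt0.
(* A state (z, (m, r)) stands for the ball of centre [z] and radius [r] for the
   seminorm [p m]. *)
pose ball (s : X * (nat * R)) := [set z | p s.2.1 (z - s.1) < s.2.2].
pose cball (s : X * (nat * R)) := [set z | p s.2.1 (z - s.1) <= s.2.2].
pose good (s : X * (nat * R)) := Y s.1 /\ 0 < s.2.2.
have step (a : nat * (X * (nat * R))) : exists t, good a.2 ->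
    good t /\ [/\ (a.1 <= t.2.1)%N, t.2.2 <= a.1.+1%:R^-1 &
    cball t `<=` ball a.2 `&` F a.1].
  case: (pselect (good a.2)) => [[Ya a0]|nga]; last by exists a.2.
  have [z [m [r [Yz r0 im ri sub]]]] := shrink_ball a.1 a.2.2.1 (oF a.1) (dF a.1) Ya a0.
  by exists (z, (m, r)).
have {step}[next nextP] := choice step.
pose s := fix s i := if i is j.+1 then next (j, s j) else (y0, (n0, e0)).
have gs i : good (s i).
  by elim: i => [|i IHi]; [split|have [] := nextP (i, s i) IHi].
have sm i : (i <= (s i.+1).2.1)%N by have [_ []] := nextP (i, s i) (gs i).
have sr i : (s i.+1).2.2 <= i.+1%:R^-1 by have [_ []] := nextP (i, s i) (gs i).
have sub i : cball (s i.+1) `<=` ball (s i) `&` F i.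
  by have [_ []] := nextP (i, s i) (gs i).
have nested i j : (i <= j)%N -> cball (s j) `<=` cball (s i).
  move=> /subnK <-; elim: (j - i)%N => // m IHm.
  by rewrite addSn; apply: subset_trans IHm => z /sub[/ltW].
have center i j : (i <= j)%N -> cball (s i) (s j).1.
  move=> /nested; apply; rewrite /cball /= subrr (seminorm0 hp) ltW//.
  by have [] := gs j.
have [|l sl] := @tvs_complete_seq _ _ _ _ hp (fun i => (s i).1) cX.
  move=> n e e_gt0.
  have [N0 _ N0e] := near_infty_natSinv_lt (PosNum (divr_gt0 e_gt0 (ltr0Sn R 1))).
  pose N := maxn n N0.
  have near i : (N < i)%N -> p n ((s i).1 - (s N.+1).1) < e / 2.
    move=> /center ci; apply: le_lt_trans (N0e N (leq_maxr _ _)).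
    apply: le_trans (sr N); apply: le_trans ci; apply: seminorm_homo => //.
    exact: leq_trans (leq_maxl _ _) (sm N).
  exists N.+1 => i j Ni Nj; rewrite [ltRHS]splitr.
  apply: le_lt_trans (seminorm_dist_triangle hp _ (s N.+1).1 _ _) _.
  by rewrite ltrD ?near// (seminorm_distC hp) near.
have lball i : cball (s i) l.
  rewrite /cball /= leNgt; apply/negP => il.
  have [|j _ /(_ (maxn i j))] :=
    sl [set x | p (s i).2.1 (x - l) < p (s i).2.1 (l - (s i).1) - (s i).2.2].
    by apply: nbhs_seminorm_ball; rewrite // subr_gt0.
  rewrite /= leq_maxr => /(_ isT); rewrite ltNge => /negP; apply.
  rewrite lerBlDr; apply: le_trans (seminorm_dist_triangle hp _ (s (maxn i j)).1 _ _) _.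
  by rewrite (seminorm_distC hp) lerD2l; apply: center; exact: leq_maxl.
exists l; last by have [] := sub 0%N _ (lball 1%N).
split; last by move=> i _; have [] := sub i _ (lball i.+1).
apply: (@closed_cvg _ _ \oo _ _ Y clY _ _ sl); apply: nearW => i.
by have [] := gs i.
Qed.
End baire.

(** * Orbits, irregular vectors and chaotic pairs *)

Section dynamics.
Context {R : realType} {k : scalar_kind} {X : tvsType (scalars R k)}.
Context {p : nat -> X -> R} (hp : defining_seminorms p).
Context (T : {linear X -> X}).
Implicit Types (x y : X) (m n : nat).

Lemma iter_linearP n a x y : iter n T (a *: x + y) = a *: iter n T x + iter n T y.
Proof. by elim: n => //= n ->; rewrite linearP. Qed.

Lemma iter_linearZ n a x : iter n T (a *: x) = a *: iter n T x.
Proof. by elim: n => //= n ->; rewrite linearZ. Qed.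

Lemma iter_linear0 n : iter n T 0 = 0.
Proof. by elim: n => //= n ->; rewrite linear0. Qed.

Lemma iter_linearB n x y : iter n T (x - y) = iter n T x - iter n T y.
Proof. by elim: n => //= n ->; rewrite linearB. Qed.

Lemma semi_irregularP x : semi_irregular p T x <->
  (forall m e, 0 < e -> frequently (fun n => p m (iter n T x) < e)) /\
  exists m e, 0 < e /\ frequently (fun n => e <= p m (iter n T x)).
Proof.
rewrite /semi_irregular (liminf_frechet_dist0P hp) (limsup_frechet_distP hp).
split=> -[fx [m [e [e0 gx]]]]; (split=> [j r r0|]; last exists m, e; last split=> //).
- by apply: sub_frequently (fx j r r0) => n; rewrite subr0.
- by apply: sub_frequently gx => n; rewrite subr0.
- by apply: sub_frequently (fx j r r0) => n; rewrite subr0.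
- by apply: sub_frequently gx => n; rewrite subr0.
Qed.

Lemma irregularP m x : irregular p T m x <->
  (forall m e, 0 < e -> frequently (fun n => p m (iter n T x) < e)) /\
  forall M, frequently (fun n => M < p m (iter n T x)).
Proof.
rewrite /irregular (liminf_frechet_dist0P hp) limn_esup_pinftyP.
by split=> -[fx gx]; split=> // j e e0; apply: sub_frequently (fx j e e0) => n;
  rewrite subr0.
Qed.

Lemma irregular_semi_irregular m x : irregular p T m x -> semi_irregular p T x.
Proof.
move=> /irregularP[fx gx]; apply/semi_irregularP; split=> //.
by exists m, 1; split=> //; apply: sub_frequently (gx 1) => n /ltW.
Qed.

Let frechet_dist_orbits x y n : frechet_dist p (iter n T x) (iter n T y) =
  frechet_dist p (iter n T (x - y)) 0.
Proof. by rewrite /frechet_dist subr0 iter_linearB. Qed.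

Lemma LY_chaotic_pairP x y : LY_chaotic_pair p T x y <-> semi_irregular p T (x - y).
Proof.
rewrite /LY_chaotic_pair.
by under eq_fun do rewrite frechet_dist_orbits.
Qed.

Lemma LY_extremely_chaotic_pairP m x y :
  LY_extremely_chaotic_pair p T m x y <-> irregular p T m (x - y).
Proof.
rewrite /LY_extremely_chaotic_pair.
under eq_fun do rewrite frechet_dist_orbits.
by under [X in limn_esup X]eq_fun do rewrite -iter_linearB.
Qed.

Lemma irregularZ m (c : scalars R k) x : 0 < scalar_abs c ->
  irregular p T m x -> irregular p T m (c *: x).
Proof.
move=> c0 /irregularP[fx gx]; apply/irregularP; split=> [j e e0|M].
  apply: sub_frequently (fx j (e / scalar_abs c) (divr_gt0 e0 c0)) => n.
  by rewrite iter_linearZ (seminormZ hp) ltr_pdivlMr// mulrC.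
apply: sub_frequently (gx (M / scalar_abs c)) => n.
by rewrite iter_linearZ (seminormZ hp) ltr_pdivrMr// mulrC.
Qed.

Lemma irregular_neq0 m x : irregular p T m x -> x != 0.
Proof.
move=> /irregularP[_ /(_ 0 0%N)[n _]]; apply: contraTneq => ->.
by rewrite iter_linear0 (seminorm0 hp) ltxx.
Qed.

(** The uncountable set is the real line spanned by the irregular vector. *)
Lemma irregular_LY_extremely_chaotic m x :
  irregular p T m x -> LY_extremely_chaotic p T m.
Proof.
move=> ix; pose f r : X := real_scalar r *: x.
have f_inj : injective f.
  move=> r s /eqP; rewrite -subr_eq0 -scalerBl scaler_eq0.
  by rewrite (negbTE (irregular_neq0 ix)) orbF subr_eq0 => /eqP/real_scalar_inj.
exists (range f); split.
  have /eq_countable -> : (range f #= [set: R])%card.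
    by apply: inj_card_eq => r s _ _; exact: f_inj.
  exact: uncountable_reals.
move=> _ _ [r _ <-] [s _ <-] rs; apply/LY_extremely_chaotic_pairP.
rewrite -scalerBl -real_scalarB; apply: irregularZ ix.
by rewrite scalar_abs_real normr_gt0 subr_eq0; apply/eqP => E; apply: rs; rewrite E.
Qed.

Lemma LY_extremely_chaotic_irregular m :
  LY_extremely_chaotic p T m -> exists x, irregular p T m x.
Proof.
move=> [K [unK KP]].
have [x Kx] : K !=set0 by apply/set0P; apply: contra_notN unK => /eqP ->.
have [y [Ky xy]] : exists y, K y /\ x <> y.
  apply: contra_notP unK => Kx'; apply: (sub_countable _ (countable1 x)).
  apply: subset_card_le => y Ky /=; apply: contra_notP Kx' => yx.
  by exists y; split=> // xy; apply: yx.
by exists (x - y); apply: (LY_extremely_chaotic_pairP m x y).1; exact: (KP x y Kx Ky xy).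
Qed.

Lemma irregular_LY_extremely_sensitive m x :
  irregular p T m x -> LY_extremely_sensitive p T m.
Proof.
move=> ix y e /(frechet_dist_lt hp)[n [e' [e'0 de]]].
(* Dividing by [1 + p n x] instead of [p n x] covers the case [p n x = 0]. *)
pose c := e' / (1 + p n x).
have px : 0 < 1 + p n x by rewrite ltr_pwDl// (seminorm_ge0 hp).
have c0 : 0 < c by rewrite divr_gt0.
have yx : y - (y - real_scalar c *: x) = real_scalar c *: x by rewrite opprB addrCA subrr addr0.
exists (y - real_scalar c *: x); split.
  apply: de; rewrite yx (seminormZ hp) scalar_abs_real ger0_norm ?ltW//.
  by rewrite /c mulrAC ltr_pdivrMr// ltr_pM2l// ltrDr.
apply/LY_extremely_chaotic_pairP; rewrite yx; apply: irregularZ ix.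
by rewrite scalar_abs_real normr_gt0 gt_eqF.
Qed.

Lemma LY_extremely_sensitive_irregular m :
  LY_extremely_sensitive p T m -> exists x, irregular p T m x.
Proof.
by move=> /(_ 0 1 ltr01)[y [_ /(LY_extremely_chaotic_pairP m 0 y).1 ?]]; exists (0 - y).
Qed.

Context (Tcont : continuous T).

Lemma continuous_iter n : continuous (iter n T).
Proof.
elim: n => [|n IHn] x; first exact: cvg_id.
have -> : iter n.+1 T = T \o iter n T by [].
apply: continuous_comp; first exact: IHn.
exact: Tcont.
Qed.

Lemma closure_invariant_subspace (V : set X) :
    V 0 -> (forall a x y, V x -> V y -> V (a *: x + y)) ->
    (forall x, V x -> V (T x)) ->
  closed_invariant_subspace T (closure V).
Proof.
move=> V0 VP VT; split.
- exact: closed_closure.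
- split; first by apply/mem_set; exact: subset_closure.
  move=> a x y /set_mem/(closure_seminormP hp) clx.
  move=> /set_mem/(closure_seminormP hp) cly; apply/mem_set/(closure_seminormP hp) => n e e0.
  have c0 : 0 < 1 + scalar_abs a by rewrite ltr_pwDl// scalar_abs_ge0.
  have e2 : 0 < e / 2 by rewrite divr_gt0.
  have [z Vz zx] := clx n (e / 2 / (1 + scalar_abs a)) (divr_gt0 e2 c0).
  have [w Vw wy] := cly n (e / 2) e2.
  exists (a *: z + w); first exact: VP.
  by rewrite opprD addrACA -scalerBr (seminorm_linear_lt hp).
- move=> _ [x /(closure_seminormP hp) clx <-]; apply/(closure_seminormP hp) => n e e0.
  have [m [d [d0 Td]]] := continuous_seminorm_bound hp x n Tcont e0.
  by have [z Vz /Td] := clx m d d0; exists (T z) => //; exact: VT.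
Qed.

(** If no seminorm has densely unbounded orbits, then for each [m] the seminorms
    [p m (T^i z)], for [i >= N], are bounded by some [M] for all [z] in a ball of
    [Y].  Translating this ball to the origin costs a factor 2, and scaling it
    by [c] then makes the bound as small as desired. *)
Lemma orbits_unbounded_or_equicontinuous (Y : set X) :
    (forall a x y, Y x -> Y y -> Y (a *: x + y)) ->
  (exists m, forall M N,
     Y `<=` closure (Y `&` [set y | exists2 i, (N <= i)%N & M < p m (iter i T y)])) \/
  (forall m e, 0 < e -> exists N n d, 0 < d /\
     forall y, Y y -> p n y < d ->
       forall i, (N <= i)%N -> p m (iter i T y) <= e).
Proof.
move=> YP; rewrite -implyNp => nD m e e0.
have [M [N [y [n [d [[Yy d0] bd]]]]]] : exists M N y n d, (Y y /\ 0 < d) /\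
    forall z, Y z -> p n (z - y) < d -> forall i, (N <= i)%N ->
      p m (iter i T z) <= M.
  apply: contrapT => nE; apply: nD; exists m => M N y Yy.
  apply/(closure_seminormP hp) => n d d0; apply: contrapT => nz; apply: nE.
  exists M, N, y, n, d; split=> // z Yz zy i Ni.
  by rewrite leNgt; apply/negP => Mz; apply: nz; exists z => //; split=> //; exists i.
have M0 : 0 <= M.
  apply: le_trans (seminorm_ge0 hp m (iter N T y)) _.
  by apply: bd; rewrite // subrr (seminorm0 hp).
(* [M + M] bounds the orbits on the translated ball; adding 1 keeps the
   denominator positive when [M = 0]. *)
pose c := e / (M + M + 1).
have c0 : 0 < c by rewrite divr_gt0// ltr_wpDl// addr_ge0.
exists N, n, (c * d); split=> [|z Yz zd i Ni]; first exact: mulr_gt0.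
pose w : X := real_scalar c^-1 *: z.
have cw (u : X) (j : nat) : p j (real_scalar c^-1 *: u) = c^-1 * p j u.
  by rewrite (seminormZ hp) scalar_abs_real ger0_norm// invr_ge0 ltW.
have : p m (iter i T w) <= M + M.
  have -> : iter i T w = iter i T (w + y) - iter i T y.
    by rewrite -iter_linearB addrK.
  apply: le_trans (seminormD hp _ _ _) _; rewrite (seminormN hp).
  apply: lerD; apply: bd; rewrite ?subrr ?(seminorm0 hp) ?addrK//.
    exact: YP.
  by rewrite cw mulrC ltr_pdivrMr// mulrC.
rewrite iter_linearZ cw mulrC ler_pdivrMr// => /le_trans; apply.
rewrite /c mulrCA ler_piMr ?(ltW e0)// ler_pdivrMr ?mul1r ?lerDl//.
by rewrite ltr_wpDl// addr_ge0.
Qed.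

End dynamics.

(** * A residual set of irregular vectors *)

Section residual.
Context {R : realType} {k : scalar_kind} {X : tvsType (scalars R k)}.
Context {p : nat -> X -> R} (hp : defining_seminorms p).
Context (T : {linear X -> X}) (Tcont : continuous T).

Lemma open_orbit_seminorm m N (D : set R) : open D ->
  open [set y | exists2 n, (N <= n)%N & D (p m (iter n T y))].
Proof.
move=> oD; rewrite (_ : mkset _ =
    \bigcup_(n in [set n | (N <= n)%N]) ((p m \o iter n T) @^-1` D)).
  apply: bigcup_open => n _; apply: open_comp => // y _.
  apply: continuous_comp; first exact: (continuous_iter Tcont).
  exact: (continuous_seminorm hp).
by apply/seteqP; split=> y [n Nn Dn]; exists n.
Qed.

(** Gathers Baire's theorem and the passage to the topological space [Y], so that
    open and dense sets can be handled inside [X]. *)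
Lemma residual_subtype (Y : set X) (F : nat -> set X) (A : set Y) :
    tvs_complete X -> closed Y -> (forall i, open (F i)) ->
    (forall i, Y `<=` closure (Y `&` F i)) ->
    (forall y : Y, (\bigcap_i F i) (set_val y) -> A y) ->
  residual A.
Proof.
move=> cX clY oF dF FA; exists (\bigcap_i (set_val @^-1` F i)); split.
- by exists (fun i => set_val @^-1` F i) => // i; exists (F i).
- move=> O [y Oy] [U oU UO]; subst O.
  have /set_mem Yy := valP y.
  have /(_ _ (open_nbhs_nbhs (conj oU Oy)))[z [[Yz Fz] Uz]] :=
    Baire_closed_subset hp cX clY oF dF Yy.
  by exists (exist _ z (mem_set Yz)); split=> //= i _; exact: Fz.
- by move=> y Fy; apply: FA => i _; exact: Fy.
Qed.

(** The subspace is the closure of the set of vectors whose orbit tends to 0 along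
    a fixed sequence of times [f i], chosen such that [x] belongs to it. *)
Lemma residual_irregular (x : X) : tvs_complete X -> semi_irregular p T x ->
  exists Y : set X, closed_invariant_subspace T Y /\
    exists m, residual [set y : set_type Y | irregular p T m (set_val y)].
Proof.
move=> cX /(semi_irregularP hp)[small [j [e0 [e0_gt0 large]]]].
have [f fP] : {f : nat -> nat | forall i, (i <= f i)%N /\
    p i (iter (f i) T x) < i.+1%:R^-1}.
  have [i|f fP] := @choice _ _ (fun i n => (i <= n)%N /\ p i (iter n T x) < i.+1%:R^-1).
    by have [|n] := small i i.+1%:R^-1 _ i; [rewrite invr_gt0|exists n].
  by exists f.
pose V := [set y | forall m e, 0 < e -> \forall i \near \oo, p m (iter (f i) T y) < e].
have Vx : V x.
  move=> m e e_gt0; near=> i.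
  apply: (@lt_trans _ _ i.+1%:R^-1); last first.
    by near: i; exact: (near_infty_natSinv_lt (PosNum e_gt0)).
  apply: le_lt_trans (fP i).2; apply: (seminorm_homo hp).
  by near: i; exact: nbhs_infty_ge.
have YP : closed_invariant_subspace T (closure V).
  apply: (closure_invariant_subspace hp Tcont).
  - by move=> m e e_gt0; apply: nearW => i; rewrite iter_linear0 (seminorm0 hp).
  - move=> a y z Vy Vz m e e_gt0.
    have c0 : 0 < 1 + scalar_abs a by rewrite ltr_pwDl// scalar_abs_ge0.
    have e2 : 0 < e / 2 by rewrite divr_gt0.
    apply: filterS2 (Vy m _ (divr_gt0 e2 c0)) (Vz m _ e2) => i yi zi.
    by rewrite iter_linearP (seminorm_linear_lt hp).
  - move=> y Vy m e e_gt0.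
    have [n [d [d0 Td]]] := continuous_seminorm_bound hp 0 m Tcont e_gt0.
    apply: filterS (Vy n d d0) => i yi.
    by rewrite -iterSr iterS -[T _]subr0 -[X in _ - X](linear0 T) Td// subr0.
exists (closure V); split=> //.
have [clY [Y0 YL] YT] := YP.
have YL' a y z : closure V y -> closure V z -> closure V (a *: y + z).
  by move=> Vy Vz; apply/set_mem/YL; exact: mem_set.
have iterY n y : closure V y -> closure V (iter n T y).
  by move=> Vy; elim: n => //= n IHn; apply: YT; exists (iter n T y).
(* In the equicontinuous case, the orbit of [x], once close to 0, stays below
   [e0 / 2] for [p j], whereas [large] brings it back to [e0]. *)
have [[m unb]|equi] := orbits_unbounded_or_equicontinuous hp T YL'; last first.
  have [N [n [d [d0 bd]]]] := equi j (e0 / 2) (divr_gt0 e0_gt0 (ltr0Sn R 1)).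
  have [i _ xi] := small n d d0 0%N.
  have [l il] := large (i + N)%N.
  rewrite leNgt => /negP; case.
  have := bd _ (iterY i x (subset_closure Vx)) xi (l - i)%N.
  rewrite leq_subRL; last exact: leq_trans (leq_addr _ _) il.
  move=> /(_ il); rewrite -iterD subnK; last exact: leq_trans (leq_addr _ _) il.
  by move=> /le_lt_trans; apply; rewrite ltr_pdivrMr// ltr_pMr// ltr1n.
exists m.
(* [A i] and [B i] decrease with [i]; hence nothing is lost by using [A i] for
   odd [i] and [B i] for even [i] only, which yields one countable family. *)
pose A i := [set y | exists2 n, (i <= n)%N & i%:R < p m (iter n T y)].
pose B i := [set y | exists2 n, (i <= n)%N & p i (iter n T y) < i.+1%:R^-1].
have oA i : open (A i).
  exact: (open_orbit_seminorm m i (@open_gt _ i%:R)).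
have oB i : open (B i).
  exact: (open_orbit_seminorm i i (@open_lt _ i.+1%:R^-1)).
apply: (@residual_subtype _ (fun i => if odd i then A i else B i)) => //.
- by move=> i; case: ifP.
- move=> i; case: ifP => _ y; first exact: unb.
  move=> Yy U Uy; have [z [Vz Uz]] := Yy _ Uy.
  exists z; split=> //; split; first exact: subset_closure.
  have iV : 0 < i.+1%:R^-1 :> R by rewrite invr_gt0.
  have [n [ni fni]] : exists n, (i <= n)%N /\ p i (iter (f n) T z) < i.+1%:R^-1.
    have [N _ NV] := Vz i _ iV.
    by exists (maxn i N); rewrite leq_maxl; split=> //; apply: NV; exact: leq_maxr.
  by exists (f n) => //; exact: leq_trans ni (fP n).1.
- move=> y Fy; apply/(irregularP hp); split=> [n e e_gt0 N|M N].
    have [K _ NK] := near_infty_natSinv_lt (PosNum e_gt0).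
    pose i := (maxn N (maxn n K)).*2.
    have le_i l : (l <= maxn N (maxn n K))%N -> (l <= i)%N.
      by move=> h; apply: leq_trans h _; rewrite /i -addnn leq_addr.
    have := Fy i I; rewrite odd_double => -[l il yl]; exists l.
      by apply: leq_trans il; apply: le_i; exact: leq_maxl.
    apply: le_lt_trans (seminorm_homo hp _ _) (lt_trans yl (NK i _)) => /=.
      by apply: le_i; rewrite !leq_max leqnn orbT.
    by apply: le_i; rewrite !leq_max leqnn !orbT.
  pose i := (maxn N (Num.trunc `|M|).+1).*2.+1.
  have le_i l : (l <= maxn N (Num.trunc `|M|).+1)%N -> (l <= i)%N.
    by move=> h; apply: leq_trans h _; rewrite /i -addnn leqW// leq_addr.
  have := Fy i I; rewrite /= odd_double /= => -[l il yl]; exists l.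
    by apply: leq_trans il; apply: le_i; exact: leq_maxl.
  apply: le_lt_trans yl; apply: le_trans (ler_norm M) _.
  apply: le_trans (ltW (truncnS_gt _)) _; rewrite ler_nat.
  by apply: le_i; exact: leq_maxr.
Unshelve. all: by end_near.
Qed.

End residual.

Theorem theorem3p33 (R : realType) (k : scalar_kind)
    (X : tvsType (scalars R k)) (p : nat -> X -> R) (T : {linear X -> X}) :
  frechet X -> ~ finite_dimensional X ->
  defining_seminorms p -> continuous T ->
  [<->
    (exists x, semi_irregular p T x);
    (exists x y, LY_chaotic_pair p T x y);
    (exists m x, irregular p T m x);
    (exists m, LY_extremely_chaotic p T m);
    (exists m, LY_extremely_sensitive p T m);
    (exists Y : set X, closed_invariant_subspace T Y /\
       exists m, residual [set y : set_type Y | irregular p T m (set_val y)])].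
Proof.
move=> [_ cX] _ hp Tcont.
(* A residual set is nonempty here, because [Y] contains 0. *)
have irregular_of_residual (Y : set X) : closed_invariant_subspace T Y ->
    (exists m, residual [set y : set_type Y | irregular p T m (set_val y)]) ->
    exists m x, irregular p T m x.
  move=> [_ [Y0 _] _] [m [G [_ dG GI]]].
  have [|y [_ /GI Gy]] := dG setT _ openT; first by exists (exist _ 0 Y0).
  by exists m, (set_val y).
tfae.
- by move=> [x sx]; exists x, 0; apply/LY_chaotic_pairP; rewrite subr0.
- move=> [x [y /LY_chaotic_pairP sxy]].
  by have [Y [YP YI]] := residual_irregular hp Tcont cX sxy;
     exact: irregular_of_residual YI.
- by move=> [m [x ix]]; exists m; exact: irregular_LY_extremely_chaotic ix.
- move=> [m /(LY_extremely_chaotic_irregular)[x ix]].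
  by exists m; exact: irregular_LY_extremely_sensitive ix.
- move=> [m /LY_extremely_sensitive_irregular[x ix]].
  exact: (residual_irregular hp Tcont cX (irregular_semi_irregular hp ix)).
- move=> [Y [YP YI]]; have [m [x ix]] := irregular_of_residual Y YP YI.
  by exists x; exact: irregular_semi_irregular ix.
Qed.
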